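(* Let $\mathcal{E}$ and $\mathcal{F}$ be Arveson systems, let $u,u'$ be normalised units of $\mathcal{E}$ and let $v,v'$ be normalised units of $\mathcal{F}$ (so that $(\mathcal{E},u)$, $(\mathcal{E},u')$, $(\mathcal{F},v)$, $(\mathcal{F},v')$ are spatial Arveson systems). Then the spatial products with respect to these units coincide as subsystems of $\mathcal{E}\otimes\mathcal{F}$: $$\mathcal{E}\,{}_u\!\otimes_v\mathcal{F}=\mathcal{E}\,{}_{u'}\!\otimes_{v'}\mathcal{F}.$$
   Context: An Arveson system is a measurable family $\mathcal{E}=(\mathcal{E}_t)_{t\ge0}$ of separable complex Hilbert spaces (measurable structure in the usual sense of Arveson's product systems) with a measurable family of unitaries $V_{s,t}:\mathcal{E}_s\otimes\mathcal{E}_t\to\mathcal{E}_{s+t}$, $s,t\ge0$, satisfying $V_{r,s+t}(1_{\mathcal{E}_r}\otimes V_{s,t})=V_{r+s,t}(V_{r,s}\otimes 1_{\mathcal{E}_t})$ for all $r,s,t\ge 0$; one identifies $\mathcal{E}_s\otimes\mathcal{E}_t$ with $\mathcal{E}_{s+t}$ via $V_{s,t}$. The zero system and one-dimensional systems are allowed. A (Arveson) subsystem $\mathcal{G}\subseteq\mathcal{E}$ is an Arveson system consisting of closed subspaces $\mathcal{G}_t\subseteq\mathcal{E}_t$ whose product unitaries are the restrictions of the $V_{s,t}$ to $\mathcal{G}_s\otimes\mathcal{G}_t$. Systems and subsystems are compared through their fibres at times $t>0$ only. A normalised unit of $\mathcal{E}$ is a measurable section $u=(u_t)_{t\ge0}$,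 $u_t\in\mathcal{E}_t$, $\|u_t\|=1$, with $u_{s+t}=u_s\otimes u_t$ for all $s,t\ge0$; the pair $(\mathcal{E},u)$ is then called a spatial Arveson system. The subsystems of an Arveson system form a complete lattice under fibrewise inclusion; $\mathcal{G}\vee\mathcal{G}'$ denotes the smallest Arveson subsystem containing $\mathcal{G}$ and $\mathcal{G}'$. The tensor product $\mathcal{E}\otimes\mathcal{F}$ is the Arveson system with fibres $\mathcal{E}_t\otimes\mathcal{F}_t$ and the obvious product. For spatial Arveson systems $(\mathcal{E},u)$, $(\mathcal{F},v)$ the spatial product is the subsystem $$\mathcal{E}\,{}_u\!\otimes_v\mathcal{F}:=(u\otimes\mathcal{F})\vee(\mathcal{E}\otimes v)\subseteq\mathcal{E}\otimes\mathcal{F},$$ where $u\otimes\mathcal{F}=(\mathbb{C}u_t\otimes\mathcal{F}_t)_{t\ge0}$ and $\mathcal{E}\otimes v=(\mathcal{E}_t\otimes\mathbb{C}v_t)_{t\ge0}$. *)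

(* Defs.v *)
From HB Require Import structures.
From mathcomp Require Import all_boot all_order all_algebra complex.
From mathcomp Require Import all_classical all_reals all_analysis.

Set Implicit Arguments.
Unset Strict Implicit.
Unset Printing Implicit Defensive.

Import Order.TTheory GRing.Theory Num.Theory Num.Def.
Import numFieldNormedType.Exports.

Local Open Scope classical_set_scope.
Local Open Scope ring_scope.

(* Separable complex Hilbert spaces; the inner product is linear in its first
   argument and conjugate-linear in the second one. *)
Record hilbert (R : realType) := Hilbert {
  hilbert_sort :> completeNormedModType R[i];
  inner : {dot hilbert_sort for conjC};
  normE : forall x : hilbert_sort, `|x| ^+ 2 = inner x x;
  separable : exists D : set hilbert_sort, countable D /\ dense D }.

Section HilbertSpaces.
Context {R : realType}.

Definition closed_subspace (H : hilbert R) (M : set H) :=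
  [/\ M 0, forall (a : R[i]) x y, M x -> M y -> M (a *: x + y) & closed M].

Definition closed_span (H : hilbert R) (A : set H) : set H :=
  [set x | forall M, closed_subspace M -> A `<=` M -> M x].

(* [tens] exhibits L as the Hilbert space tensor product of H and K. As this
   determines L up to a unique unitary compatible with the elementary tensors,
   a bilinear map satisfying this predicate is the same thing as (the
   composition with (x, y) |-> x (x) y of) a unitary from H (x) K onto L. *)
Definition hilbert_tensor (H K L : hilbert R) (tens : H -> K -> L) :=
  [/\ bilinear_for *:%R *:%R tens,
      forall x x' y y',
        inner L (tens x y) (tens x' y') = inner H x x' * inner K y y' &
      closed_span [set tens x y | x in setT & y in setT] = setT].

(* A (x) B, as a closed subspace of H (x) K = L *)
Definition tensor_subspace (H K L : hilbert R) (tens : H -> K -> L)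
    (A : set H) (B : set K) : set L :=
  closed_span [set tens x y | x in A & y in B].

Definition line (H : hilbert R) (x : H) : set H :=
  [set a *: x | a in [set: R[i]]].

Definition cmeasurable_fun d (T : measurableType d) (D : set T) (f : T -> R[i]) :=
  measurable_fun D (fun x => complex.Re (f x)) /\
  measurable_fun D (fun x => complex.Im (f x)).

(* Borel measurability of functions of one or two times in [0, +oo[. The norm
   only serves to see an element of [0, +oo[ as an element of {nonneg R}. *)
Definition time_measurable (f : {nonneg R} -> R[i]) :=
  cmeasurable_fun (T := measurableTypeR R) [set` `[0, +oo[]
    (fun t : R => f (`|t|%:nng)).

Definition time2_measurable (f : {nonneg R} -> {nonneg R} -> R[i]) :=
  cmeasurable_fun (T := (measurableTypeR R * measurableTypeR R)%type)
    ([set` `[0, +oo[] `*` [set` `[0, +oo[])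
    (fun p : R * R => f (`|p.1|%:nng) (`|p.2|%:nng)).

(* Measurable structures on a family of separable Hilbert spaces, given by
   the set of the measurable sections. *)
Definition measurable_structure (E : {nonneg R} -> hilbert R)
    (M : set (forall t, E t)) :=
  [/\ forall x y, M x -> M y -> time_measurable (fun t => inner (E t) (x t) (y t)),
      forall x : forall t, E t,
        (forall y, M y -> time_measurable (fun t => inner (E t) (x t) (y t))) ->
        M x &
      exists2 e : nat -> forall t, E t, (forall n, M (e n)) &
        forall t, closed_span (range (fun n => e n t)) = setT].

End HilbertSpaces.

(* [pmul h x y] is the image V_{s,t} (x (x) y) in the fibre at time r = s + t.
   Making r a parameter avoids transports between the (only propositionally
   equal) times r + (s + t) and (r + s) + t; there is no additional freedom
   since r and the proof h are determined by s and t. *)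
Record arveson (R : realType) := Arveson {
  fibre :> {nonneg R} -> hilbert R;
  msection : set (forall t, fibre t);
  pmul : forall s t r : {nonneg R}, r%:num = s%:num + t%:num ->
    fibre s -> fibre t -> fibre r;
  msectionP : measurable_structure msection;
  pmul_tensor : forall (s t r : {nonneg R}) (h : r%:num = s%:num + t%:num),
    hilbert_tensor (pmul h);
  pmulA : forall (r s t rs st rst : {nonneg R})
    (hrs : rs%:num = r%:num + s%:num) (hst : st%:num = s%:num + t%:num)
    (hl : rst%:num = rs%:num + t%:num) (hr : rst%:num = r%:num + st%:num)
    (x : fibre r) (y : fibre s) (z : fibre t),
    pmul hr x (pmul hst y z) = pmul hl (pmul hrs x y) z;
  pmul_measurable : forall x y z,
    msection x -> msection y -> msection z ->
    time2_measurable (fun s t =>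
      inner (fibre (s%:num + t%:num)%:nng)
        (@pmul s t (s%:num + t%:num)%:nng erefl (x s) (y t))
        (z (s%:num + t%:num)%:nng)) }.

Section ArvesonSystems.
Context {R : realType}.

Definition normalised_unit (E : arveson R) (u : forall t, E t) :=
  [/\ msection u,
      forall t, `|u t| = 1 &
      forall (s t r : {nonneg R}) (h : r%:num = s%:num + t%:num),
        pmul h (u s) (u t) = u r].

(* The measurable sections of a subsystem G are those of E with values in G. *)
Definition subsystem (E : arveson R) (G : forall t, set (E t)) :=
  [/\ forall t, closed_subspace (G t),
      forall (s t r : {nonneg R}) (h : r%:num = s%:num + t%:num),
        tensor_subspace (pmul h) (G s) (G t) = G r &
      exists2 e : nat -> forall t, E t,
        (forall n, msection (e n) /\ forall t, G t (e n t)) &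
        forall t, closed_span (range (fun n => e n t)) = G t].

Definition subfamily (E : arveson R) (G G' : forall t, set (E t)) :=
  forall t : {nonneg R}, 0 < t%:num -> G t `<=` G' t.

(* The supremum of G and G' in the lattice of subsystems: the intersection of
   the subsystems containing both, which is the smallest one, see [joinP]. *)
Definition join (E : arveson R) (G G' : forall t, set (E t))
    (t : {nonneg R}) : set (E t) :=
  [set x | forall S, subsystem S -> subfamily G S -> subfamily G' S -> S t x].
Arguments join {E} G G' t.

Definition smallest_subsystem (E : arveson R) (G G' S : forall t, set (E t)) :=
  [/\ subsystem S, subfamily G S, subfamily G' S &
      forall S', subsystem S' -> subfamily G S' -> subfamily G' S' ->
        subfamily S S'].

Lemma joinP (E : arveson R) (G G' S : forall t, set (E t)) :
  smallest_subsystem G G' S ->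
  forall t : {nonneg R}, 0 < t%:num -> join G G' t = S t.
Proof.
move=> [sS GS G'S minS] t t0; apply/seteqP; split => x /=; first exact.
by move=> Sx S' sS' GS' G'S'; exact: (minS S' sS' GS' G'S' t t0 x Sx).
Qed.

(* The tensor product of two systems: any Arveson system with fibres
   E_t (x) F_t, product (x (x) y)(x' (x) y') = xx' (x) yy' and the measurable
   structure for which x (x) y is measurable whenever x and y are. This
   determines it up to a unique isomorphism. *)
Record tensor_system (E F : arveson R) := TensorSystem {
  tsystem :> arveson R;
  tens : forall t, E t -> F t -> tsystem t;
  tens_tensor : forall t, hilbert_tensor (@tens t);
  tens_pmul : forall (s t r : {nonneg R}) (h : r%:num = s%:num + t%:num)
    (x : E s) (y : F s) (x' : E t) (y' : F t),
    pmul h (tens x y) (tens x' y') = tens (pmul h x x') (pmul h y y');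
  tens_measurable : forall (x : forall t, E t) (y : forall t, F t),
    msection x -> msection y -> msection (fun t => tens (x t) (y t)) }.

Definition spatial_product (E F : arveson R) (EF : tensor_system E F)
    (u : forall t, E t) (v : forall t, F t) : forall t, set (EF t) :=
  join (fun t => tensor_subspace (@tens _ _ EF t) (line (u t)) setT)
       (fun t => tensor_subspace (@tens _ _ EF t) setT (line (v t))).

End ArvesonSystems.

Arguments join {R E} G G' t.
Arguments spatial_product {R E F} EF u v t.

(* Main.v *)
Require Import Defs.
From mathcomp Require Import all_boot all_order all_algebra complex.
From mathcomp Require Import all_classical all_reals all_analysis.
From mathcomp Require Import ring lra.

(* It suffices that a subsystem S containing u (x) F and E (x) v contains every
   z = x (x) v'_T with x in E_T. Let phi(s) be the squared distance of z from
   S_s (x) (E (x) F)_{T-s}. The projections onto S over disjoint time intervals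
   commute and multiply, so phi(s + h) - phi(s) is at most the squared distance
   of z from the vectors which lie in S over [s, s + h]. Decompose v'_h into its
   component along v_h and a rest w_h, with |w_h|^2 = 1 - |<v'_h, v_h>|^2 = O(h):
   the first part lies in E (x) v, and the second one only has to be corrected
   where x is not u_h on [s, s + h]. Hence this squared distance is at most
   O(h) |x - P x|^2, P being the projection onto E_s (x) u_h (x) E_{T-s-h}.
   As P x -> x when h -> 0, phi has right derivative 0, and phi vanishes.
   That P x -> x follows from separability: a vector y orthogonal to all the
   u_h (x) E_{r-h} yields the pairwise orthogonal vectors u_s (x) y (x) u_{1-s},
   0 <= s <= 1. *)

Set Implicit Arguments.
Unset Strict Implicit.
Unset Printing Implicit Defensive.

Import Order.TTheory GRing.Theory Num.Theory.

Local Open Scope classical_set_scope.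
Local Open Scope ring_scope.

(** * Geometry of Hilbert spaces *)

Section SpatialProduct.
Context {R : realType}.
Implicit Types H K L : hilbert R.

(** The squared modulus, valued in [R] rather than in [R[i]], so that all estimates are made over an
    ordered field. [sqn] does the same for the norm. *)
Definition csq (a : R[i]) : R := complex.Re a ^+ 2 + complex.Im a ^+ 2.

Lemma csq_ge0 a : 0 <= csq a.
Proof. by rewrite addr_ge0 ?sqr_ge0. Qed.

Lemma csqM a b : csq (a * b) = csq a * csq b.
Proof. by case: a b => [a b] [c d]; rewrite /csq /=; ring. Qed.

Lemma csq_eq0 a : csq a = 0 -> a = 0.
Proof.
case: a => [a b] /eqP; rewrite /csq /= paddr_eq0 ?sqr_ge0 // !sqrf_eq0.
by move=> /andP[/eqP -> /eqP ->].
Qed.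

Definition sqn H (x : H) : R := complex.Re (inner H x x).

Lemma inner_self H (x : H) : inner H x x = (sqn x)%:C%C.
Proof. by rewrite /sqn complex.RRe_real // ger0_real // dnorm_ge0. Qed.

Lemma norm_sqn H (x : H) : `|x| ^+ 2 = (sqn x)%:C%C.
Proof. by rewrite normE inner_self. Qed.

Lemma sqn_ge0 H (x : H) : 0 <= sqn x.
Proof. by rewrite -complex.ler0c -inner_self dnorm_ge0. Qed.

Lemma sqn_eq0 H (x : H) : sqn x = 0 -> x = 0.
Proof. by move=> x0; apply/eqP; rewrite -(dnorm_eq0 (inner H)) inner_self x0. Qed.

Lemma sqn0 H : sqn (0 : H) = 0.
Proof. by rewrite /sqn linear0l. Qed.

Lemma inner_conj H (x y : H) : inner H y x = (inner H x y)^*%C.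
Proof. by rewrite hermC expr0 mul1r. Qed.

Lemma innerC0 H (x y : H) : inner H x y = 0 -> inner H y x = 0.
Proof. by rewrite (inner_conj x y) => ->; rewrite conjc0. Qed.

Lemma innerPl H a (x y z : H) :
  inner H (a *: x + y) z = a * inner H x z + inner H y z.
Proof. by rewrite linearDl /= linearZl_LR. Qed.

Lemma sqnD H (x y : H) :
  sqn (x + y) = sqn x + sqn y + 2 * complex.Re (inner H x y).
Proof.
rewrite /sqn linearDl /= !linearDr /= (inner_conj x y).
by case: (inner H x y) (inner H x x) (inner H y y) => a b [c d] [e f] /=; ring.
Qed.

Lemma sqnZ H a (x : H) : sqn (a *: x) = csq a * sqn x.
Proof. by rewrite /sqn dnormZ inner_self -add_Re2_Im2 /= /csq; ring. Qed.

Lemma sqnN H (x : H) : sqn (- x) = sqn x.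
Proof. by rewrite /sqn hnormN. Qed.

Lemma sqnB H (x y : H) :
  sqn (x - y) = sqn x + sqn y - 2 * complex.Re (inner H x y).
Proof. by rewrite sqnD sqnN linearNr raddfN mulrN. Qed.

Lemma sqnBC H (x y : H) : sqn (x - y) = sqn (y - x).
Proof. by rewrite -sqnN opprB. Qed.

Lemma sqnD_le H (x y : H) : sqn (x + y) <= 2 * (sqn x + sqn y).
Proof. by have := sqn_ge0 (x - y); rewrite sqnB sqnD; lra. Qed.

Lemma sqnB_trans H (y x z : H) : sqn (x - z) <= 2 * (sqn (x - y) + sqn (y - z)).
Proof. by have := sqnD_le (x - y) (y - z); rewrite subrKA. Qed.

Lemma sqnD_orth H (x y : H) : inner H x y = 0 -> sqn (x + y) = sqn x + sqn y.
Proof. by move=> xy; rewrite sqnD xy mulr0 addr0. Qed.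

Lemma lt_norm_sqn H (x : H) (e : R) : 0 < e -> sqn x < e ^+ 2 -> `|x| < e%:C%C.
Proof.
move=> e0 xe; rewrite -(@ltr_pXn2r _ 2) ?nnegrE ?ler0c ?(ltW e0) //.
by rewrite norm_sqn -rmorphXn ltcR.
Qed.

Lemma lt_sqn_norm H (x : H) (e : R) : `|x| < e%:C%C -> sqn x < e ^+ 2.
Proof.
move=> xe; have e0 : 0 < e%:C%C by apply: le_lt_trans xe.
rewrite -ltcR -norm_sqn rmorphXn ltr_pXn2r // nnegrE //; exact: ltW.
Qed.

Lemma nbhs_sqn H (x : H) (B : set H) :
  nbhs x B <-> exists2 e : R, 0 < e & forall y, sqn (x - y) < e -> B y.
Proof.
rewrite nbhs_ballP; split=> [[e /= e0 eB]|[e e0 eB]].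
  have er : (complex.Re e)%:C%C = e by rewrite complex.RRe_real // gtr0_real.
  have e0' : 0 < complex.Re e by rewrite -ltcR er.
  exists (complex.Re e ^+ 2); first by rewrite exprn_gt0.
  move=> y xy; apply: eB; rewrite -ball_normE /= -er.
  exact: lt_norm_sqn.
exists (Num.sqrt e)%:C%C; first by rewrite /= ltcR sqrtr_gt0.
move=> y; rewrite -ball_normE /= => /lt_sqn_norm; rewrite sqr_sqrtr ?ltW //.
exact: eB.
Qed.

Lemma closed_sqnP H (M : set H) :
  closed M <->
  forall x, (forall e : R, 0 < e -> exists2 y, M y & sqn (x - y) < e) -> M x.
Proof.
split=> [cM x xM|cM x /= xM].
  apply: cM => B /nbhs_sqn[e e0 eB]; have [y My xy] := xM e e0.
  by exists y; split=> //; apply: eB.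
apply: cM => e e0; have [|y [My xy]] := xM [set y | sqn (x - y) < e].
  by apply/nbhs_sqn; exists e.
by exists y.
Qed.

Lemma closed_subspaceD H (M : set H) x y :
  closed_subspace M -> M x -> M y -> M (x + y).
Proof. by case=> _ lM _ Mx My; rewrite -[x]scale1r; apply: lM. Qed.

Lemma closed_subspaceZ H (M : set H) a x :
  closed_subspace M -> M x -> M (a *: x).
Proof. by case=> M0 lM _ Mx; rewrite -[_ *: _]addr0; apply: lM. Qed.

Lemma closed_subspaceB H (M : set H) x y :
  closed_subspace M -> M x -> M y -> M (x - y).
Proof.
move=> cM Mx My; apply: closed_subspaceD => //.
by rewrite -scaleN1r; apply: closed_subspaceZ.
Qed.

Lemma closed_span_subspace H (A : set H) : closed_subspace (closed_span A).
Proof.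
split=> [M [] //|a x y Ax Ay M cM AM|].
  by case: (cM) => _ lM _; apply: lM; [apply: Ax|apply: Ay].
apply/closed_sqnP => x xA M cM AM; case: (cM) => _ _ /closed_sqnP; apply => e e0.
by have [y Ay xy] := xA e e0; exists y => //; apply: Ay.
Qed.

Lemma sub_closed_span H (A : set H) : A `<=` closed_span A.
Proof. by move=> x Ax M _; apply. Qed.

(* [linear] in the unbundled form, so as to apply to partial applications of
   bilinear maps that are not canonically so. *)
Definition bounded_linear H K (f : H -> K) :=
  (forall a x y, f (a *: x + y) = a *: f x + f y) /\
  exists2 C, 0 < C & forall x, sqn (f x) <= C * sqn x.

Lemma linear_sub H K (f : H -> K) :
  (forall a x y, f (a *: x + y) = a *: f x + f y) ->
  forall x y, f (x - y) = f x - f y.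
Proof. by move=> lf x y; rewrite addrC -scaleN1r lf scaleN1r addrC. Qed.

(** With this, a claim that some bounded linear image of a vector lies in a closed subspace has to
    be checked on elementary tensors only. *)
Lemma closed_subspace_preimage H K (f : H -> K) (M : set K) :
  bounded_linear f -> closed_subspace M -> closed_subspace (f @^-1` M).
Proof.
move=> [lf [C C0 fC]] cM; have [M0 lM clM] := cM; split=> /=.
- by rewrite -(subrr 0) (linear_sub lf) subrr.
- by move=> a x y /= Mx My; rewrite lf; apply: lM.
apply/closed_sqnP => x xM /=; apply: ((closed_sqnP M).1 clM) => e e0.
have [|y /= My xy] := xM (e / C); first by rewrite divr_gt0.
exists (f y) => //; rewrite -(linear_sub lf) (le_lt_trans (fC _)) //.
by rewrite mulrC -ltr_pdivlMr.
Qed.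

Lemma sqn_sub_proj H (x y : H) : sqn y != 0 ->
  sqn (x - (inner H x y / (sqn y)%:C%C) *: y) = sqn x - csq (inner H x y) / sqn y.
Proof.
move=> y0; rewrite sqnB sqnZ linearZr_LR /=; set c := inner H x y.
have -> : complex.Re ((c / (sqn y)%:C%C)^*%C * c) = csq c / sqn y.
  rewrite -fmorphV /csq; move: (sqn y)^-1 => k.
  by case: c => a b /=; ring.
have -> : csq (c / (sqn y)%:C%C) * sqn y = csq c / sqn y.
  rewrite -fmorphV csqM /csq /= expr0n addr0 -mulrA; congr (_ * _).
  by rewrite expr2 -mulrA mulVf ?mulr1.
by ring.
Qed.

Lemma inner0_sqn_min H (x y : H) :
  (forall a : R[i], sqn x <= sqn (x - a *: y)) -> inner H x y = 0.
Proof.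
move=> xmin; have [y0|y0] := eqVneq (sqn y) 0; first by rewrite (sqn_eq0 y0) linear0r.
have := xmin (inner H x y / (sqn y)%:C%C); rewrite sqn_sub_proj // lerBrDr gerDl => c0.
apply: csq_eq0; apply/eqP; rewrite eq_le csq_ge0 andbT.
by rewrite pmulr_lle0 // in c0; rewrite invr_gt0 lt_neqAle eq_sym y0 sqn_ge0.
Qed.

Lemma closed_subspace_orth H (y : H) : closed_subspace [set x | inner H x y = 0].
Proof.
split=> /=; first by rewrite linear0l.
  by move=> a x z /= xy zy; rewrite innerPl xy zy mulr0 addr0.
apply/closed_sqnP => x xM /=.
have [y0|y0] := eqVneq (sqn y) 0; first by rewrite (sqn_eq0 y0) linear0r.
have y0' : 0 < sqn y by rewrite lt_neqAle eq_sym y0 sqn_ge0.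
apply: csq_eq0; apply/eqP; rewrite eq_le csq_ge0 andbT leNgt; apply/negP => c0.
have [|z /= zy xz] := xM (csq (inner H x y) / sqn y); first by rewrite divr_gt0.
(* This is Cauchy-Schwarz for [x - z] and [y], where [z] is orthogonal to [y]. *)
have := sqn_ge0 ((x - z) - (inner H (x - z) y / (sqn y)%:C%C) *: y).
by rewrite sqn_sub_proj // linearBl /= zy subr0; move: xz; lra.
Qed.

(** The difference of the two sides is [sqn (t *: x - y)]. For small [t] the factor in front of
    [sqn x] is close to 1, whereas [sqnD_le] loses a factor 2. *)
Lemma sqnD_weight H (t : R) (x y : H) :
  t * sqn (x + y) <= (1 + t) * (t * sqn x + sqn y).
Proof.
have := sqn_ge0 (t%:C%C *: x - y); rewrite sqnB sqnZ linearZl_LR /= sqnD /csq /=.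
by case: (inner H x y) => a b /=; rewrite expr0n /= addr0 mul0r subr0; nra.
Qed.

(** * Completeness and orthogonal projections *)

Lemma hilbert_complete H (m : nat -> H) :
  (forall e : R, 0 < e ->
    exists N, forall n k, (N <= n)%N -> (N <= k)%N -> sqn (m n - m k) < e) ->
  exists p, forall e : R, 0 < e ->
    exists N, forall n, (N <= n)%N -> sqn (p - m n) < e.
Proof.
move=> mC; have /cauchy_cvgP mcvg : cauchy (m @ \oo).
  apply: cauchy_exP => e e0.
  have er : (complex.Re e)%:C%C = e by rewrite complex.RRe_real // gtr0_real.
  have e0' : 0 < complex.Re e by rewrite -ltcR er.
  have [|N mN] := mC (complex.Re e ^+ 2); first by rewrite exprn_gt0.
  exists (m N); exists N => // n /= Nn.
  by rewrite -ball_normE /= -er; apply: lt_norm_sqn => //; apply: mN.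
exists (lim (m @ \oo)) => e e0.
have /mcvg[N _ mN] : nbhs (lim (m @ \oo)) [set y | sqn (lim (m @ \oo) - y) < e].
  by apply/nbhs_sqn; exists e.
by exists N => n; apply: mN.
Qed.

Lemma invS_lt (e : R) : 0 < e -> exists N, forall n, (N <= n)%N -> n.+1%:R^-1 < e.
Proof.
move=> e0; exists (Num.bound e^-1) => n Nn.
rewrite invf_plt ?posrE // (lt_le_trans (archi_boundP _)) ?invr_ge0 ?ltW //.
by rewrite ltr_nat ltnS.
Qed.

(** A minimising sequence for the distance is Cauchy by the parallelogram identity. Its limit
    realises the infimum, and a minimiser has orthogonal difference by varying it along each vector
    of [M]. *)
Lemma orthogonal_projection_point H (M : set H) x : closed_subspace M ->
  exists2 p, M p & forall m, M m -> inner H (x - p) m = 0.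
Proof.
move=> cM; have [M0 lM clM] := cM.
pose D := [set sqn (x - m) | m in M]; pose d := inf D.
have D0 : D !=set0 by exists (sqn (x - 0)), 0.
have Dlb : lbound D 0 by move=> _ [m _ <-]; apply: sqn_ge0.
have hD : has_inf D by split=> //; exists 0.
have dM m : M m -> d <= sqn (x - m) by move=> Mm; apply: ge_inf; [case: hD|exists m].
have /choice[m mP] : forall n, exists m, M m /\ sqn (x - m) < d + n.+1%:R^-1.
  move=> n; have n0 : 0 < n.+1%:R^-1 :> R by rewrite invr_gt0.
  by have [_ [m Mm <-] xm] := inf_adherent n0 hD; exists m.
have mC (e : R) : 0 < e ->
    exists N, forall n k, (N <= n)%N -> (N <= k)%N -> sqn (m n - m k) < e.
  move=> e0; have [|N NP] := invS_lt (e := e / 4); first by rewrite divr_gt0.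
  exists N => n k /NP ne /NP ke.
  have [[Mn xn] [Mk xk]] := (mP n, mP k).
  (* The midpoint lies in [M], so its squared distance from [x] is at least [d]. *)
  have := dM (2^-1 *: (m n + m k)) (closed_subspaceZ _ cM (closed_subspaceD cM Mn Mk)).
  have : sqn (x - m n + (x - m k)) = 4 * sqn (x - 2^-1 *: (m n + m k)).
    have -> : x - m n + (x - m k) = 2 *: (x - 2^-1 *: (m n + m k)).
      rewrite scalerBr scalerA divff ?pnatr_eq0 // scale1r scaler_nat mulr2n.
      by rewrite addrACA opprD.
    rewrite sqnZ; congr (_ * _).
    by rewrite /csq (_ : 2 = 2%:C%C) ?rmorphMn //=; ring.
  have -> : m n - m k = (x - m k) - (x - m n) by rewrite opprB [RHS]addrC subrKA.
  rewrite (sqnD (x - m n)) (sqnB (x - m k)) (inner_conj (x - m n)).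
  move: ne ke xn xk; move: n.+1%:R^-1 k.+1%:R^-1 => i j.
  by case: (inner H _ _) => a b /=; lra.
have [p pm] := hilbert_complete mC.
have Mp : M p.
  apply: ((closed_sqnP M).1 clM) => e /pm[N pN].
  by exists (m N); [case: (mP N)|apply: pN].
have pd (e : R) : 0 < e -> sqn (x - p) <= d + e.
  move=> e0.
  have d0 : 0 <= d by apply: lb_le_inf.
  (* The weight [t] makes the excess [t * sqn (x - m n)] at most [e / 4], since [sqn (x - m n)] is
     at most [d + 1] for large [n]. *)
  have [t t0 te] : exists2 t : R, 0 < t & t * (d + 1) = e / 4.
    by exists (e / (4 * (d + 1))); [rewrite divr_gt0 //; lra|field; lra].
  have e4 : 0 < e / 4 by rewrite divr_gt0.
  have [|N1 NP1] := pm (t * (e / 4) / (1 + t)).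
    by apply: divr_gt0; [apply: mulr_gt0|lra].
  have [|N2 NP2] := invS_lt (e := Num.min 1 (e / 4)).
    by rewrite lt_min ltr01.
  have [_] := mP (maxn N1 N2).
  have := NP2 _ (leq_maxr N1 N2); have := NP1 _ (leq_maxl N1 N2).
  move: (maxn N1 N2) => n; rewrite lt_min ltr_pdivlMr ?addr_gt0 // => pn /andP[n1 n4] xn.
  have := sqnD_weight t (x - m n) (m n - p).
  rewrite subrKA (sqnBC (m n)) => h.
  have [k [k1 k4 xk]] : exists k : R, [/\ k < 1, k < e / 4 & sqn (x - m n) < d + k].
    by exists n.+1%:R^-1.
  have xd : sqn (x - m n) <= d + 1 by lra.
  suff : t * sqn (x - p) <= t * (d + e) by rewrite ler_pM2l.
  have : t * sqn (x - m n) <= t * (d + k) by rewrite ler_pM2l // ltW.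
  have : t * k <= t * (e / 4) by rewrite ler_pM2l // ltW.
  have : t * (t * sqn (x - m n)) <= t * (t * (d + 1)).
    by rewrite !ler_pM2l.
  have : 0 < t * e by rewrite mulr_gt0.
  by rewrite te; move: h pn; lra.
exists p => // y My; apply: inner0_sqn_min => a.
rewrite -addrA -opprD; apply: le_trans (dM _ _); first exact/ler_addgt0Pr.
by apply: closed_subspaceD => //; apply: closed_subspaceZ.
Qed.

Lemma orthogonal_projection H (M : set H) : closed_subspace M ->
  exists2 P : H -> H, bounded_linear P /\ (forall x, M (P x)) &
    forall x m, M m -> inner H (x - P x) m = 0.
Proof.
move=> cM; have /choice[P PM] : forall x : H, exists p : H, M p /\
    forall m, M m -> inner H (x - p) m = 0.
  by move=> x; have [p] := orthogonal_projection_point x cM; exists p.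
have MP x : M (P x) by case: (PM x).
have oP x m : M m -> inner H (x - P x) m = 0 by case: (PM x) => _; apply.
exists P => //; split=> //; split=> [a x y|].
  apply/eqP; rewrite -subr_eq0; apply/eqP/sqn_eq0.
  (* The defect of linearity lies in [M] and is also orthogonal to [M], so it vanishes. *)
  set q := _ - _; have Mq : M q.
    by apply: closed_subspaceB => //; apply: closed_subspaceD => //;
       apply: closed_subspaceZ.
  have : inner H (a *: (x - P x) + (y - P y) - (a *: x + y - P (a *: x + y))) q = 0.
    by rewrite linearBl /= innerPl !oP // mulr0 add0r subr0.
  have -> : a *: (x - P x) + (y - P y) - (a *: x + y - P (a *: x + y)) = q.
    by rewrite /q scalerBr addrACA -opprD opprB [LHS]addrC subrKA.
  by rewrite /sqn => ->.
exists 1 => // x; rewrite mul1r -{2}(subrK (P x) x) sqnD_orth ?lerDr ?sqn_ge0 ?oP //.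
Qed.

Lemma closed_subspace_total H (M : set H) : closed_subspace M ->
  (forall y, (forall m, M m -> inner H y m = 0) -> y = 0) -> M = setT.
Proof.
move=> cM Mtot; apply/seteqP; split=> // x _.
have [p Mp xp] := orthogonal_projection_point x cM.
by rewrite -(subrK p x) (Mtot _ xp) add0r.
Qed.

(* The balls of radius half the distance of two of the vectors are disjoint,
   and each contains a point of a countable dense set. *)
Lemma no_uncountable_orthogonal H (y : R -> H) (c : R) : 0 < c ->
  (forall s : R, 0 <= s <= 1 -> sqn (y s) = c) ->
  (forall s t : R, 0 <= s -> s < t -> t <= 1 -> inner H (y s) (y t) = 0) -> False.
Proof.
move=> c0 yc yo; have [D [cD dD]] := separable H.
have /choice[f fP] : forall s, exists z, D z /\ sqn (y s - z) < c / 2.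
  move=> s; have [||z [/= sz Dz]] := dD (interior [set z | sqn (y s - z) < c / 2]).
  - exists (y s); apply/nbhs_sqn; exists (c / 2) => //; first by rewrite divr_gt0.
  - exact: open_interior.
  - by exists z; split=> //; apply: (interior_subset sz).
have finj : {in (`[0, 1]%classic : set R) &, injective f}.
  suff lt_f (s t : R) : 0 <= s -> s < t -> t <= 1 -> f s <> f t.
    move=> s t; rewrite !inE /= !in_itv /= => /andP[s0 s1] /andP[t0 t1] st.
    by case: (ltgtP s t) => // h; [case: (lt_f _ _ s0 h t1)|case: (lt_f _ _ t0 h s1)].
  move=> s0 st t1 fst; have [[_ sf] [_ tf]] := (fP s, fP t).
  have := sqnB_trans (f s) (y s) (y t); rewrite (sqnBC (f s)) {2}fst.
  have yy : complex.Re (inner H (y s) (y t)) = 0 by rewrite yo.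
  have ys : sqn (y s) = c by apply: yc; apply/andP; split; lra.
  have yt : sqn (y t) = c by apply: yc; apply/andP; split; lra.
  by rewrite sqnB yy ys yt; move: sf tf; lra.
have : countable (`[0, 1]%classic : set R).
  have /countable_injP[g gi] := cD; apply/countable_injP; exists (g \o f).
  by move=> s t s1 t1 /gi fst; apply: finj => //; apply: fst;
    rewrite inE; case: (fP s); case: (fP t).
(* The interval [0, 1] has Lebesgue measure 1, so it cannot be countable. *)
move=> /countable_lebesgue_measure0; rewrite lebesgue_measure_itv /= lte_fin ltr01.
by rewrite oppr0 adde0 => -[] /eqP; rewrite oner_eq0.
Qed.

(** * Tensor products *)

Lemma closed_span_ind H (A M : set H) :
  closed_subspace M -> A `<=` M -> closed_span A `<=` M.
Proof. by move=> cM AM x; apply. Qed.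

Lemma tensor_subspace_ind H K L (t : H -> K -> L) A B (M : set L) :
  closed_subspace M -> (forall x y, A x -> B y -> M (t x y)) ->
  tensor_subspace t A B `<=` M.
Proof. by move=> cM AM; apply: closed_span_ind => // _ [x Ax [y By <-]]; apply: AM. Qed.

Lemma mem_tensor_subspace H K L (t : H -> K -> L) (A : set H) (B : set K) x y :
  A x -> B y -> tensor_subspace t A B (t x y).
Proof. by move=> Ax By; apply: sub_closed_span; exists x => //; exists y. Qed.

Lemma tensor_subspace_closed H K L (t : H -> K -> L) (A : set H) (B : set K) :
  closed_subspace (tensor_subspace t A B).
Proof. exact: closed_span_subspace. Qed.

Section Tensor.
Variables (H K L : hilbert R) (t : H -> K -> L).
Hypothesis tP : hilbert_tensor t.

Lemma tensPl y a x x' : t (a *: x + x') y = a *: t x y + t x' y.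
Proof. by case: tP => -[-> _]. Qed.

Lemma tensPr x a y y' : t x (a *: y + y') = a *: t x y + t x y'.
Proof. by case: tP => -[_ ->]. Qed.

Lemma inner_tens x y x' y' :
  inner L (t x y) (t x' y') = inner H x x' * inner K y y'.
Proof. by case: tP. Qed.

Lemma sqn_tens x y : sqn (t x y) = sqn x * sqn y.
Proof. by rewrite {1}/sqn inner_tens !inner_self /= mul0r subr0. Qed.

Lemma bounded_linear_tensl y : bounded_linear (t^~ y).
Proof.
split=> [a x x'|]; first exact: tensPl.
exists (1 + sqn y) => [|x]; first by rewrite ltr_pwDl ?sqn_ge0.
rewrite sqn_tens mulrC mulrDl mul1r. by rewrite lerDr sqn_ge0.
Qed.

Lemma bounded_linear_tensr x : bounded_linear (t x).
Proof.
split=> [a y y'|]; first exact: tensPr.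
exists (1 + sqn x) => [|y]; first by rewrite ltr_pwDl ?sqn_ge0.
by rewrite sqn_tens mulrDl mul1r lerDr sqn_ge0.
Qed.

Lemma tens_ind (M : set L) : closed_subspace M ->
  (forall x y, M (t x y)) -> forall z, M z.
Proof.
move=> cM tM z; have [_ _ tT] := tP.
suff : setT `<=` M by apply.
by rewrite -tT; apply: closed_span_ind => // _ [x _ [y _ <-]].
Qed.

Lemma tensl0 y : t 0 y = 0.
Proof. by rewrite -(subrr 0) (linear_sub (tensPl y)) subrr. Qed.

Lemma tensr0 x : t x 0 = 0.
Proof. by rewrite -(subrr 0) (linear_sub (tensPr x)) subrr. Qed.

Lemma tensZl a x y : t (a *: x) y = a *: t x y.
Proof. by rewrite -[a *: x]addr0 tensPl tensl0 addr0. Qed.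

Lemma tensZr a x y : t x (a *: y) = a *: t x y.
Proof. by rewrite -[a *: y]addr0 tensPr tensr0 addr0. Qed.

Lemma tensBl x x' y : t (x - x') y = t x y - t x' y.
Proof. exact: (linear_sub (tensPl y)). Qed.

Lemma tensBr x y y' : t x (y - y') = t x y - t x y'.
Proof. exact: (linear_sub (tensPr x)). Qed.

(* A (x) K and H (x) B have commuting orthogonal projections, the product of
   which is the projection onto A (x) B. *)
Lemma tensor_subspace_dist (A : set H) (B : set K) z m n :
  closed_subspace A ->
  tensor_subspace t A setT m -> tensor_subspace t setT B n ->
  exists2 p, tensor_subspace t A B p &
    sqn (z - p) <= sqn (z - m) + sqn (z - n).
Proof.
move=> cA Am Bn.
have [PA [PAl AP] PAo] := orthogonal_projection cA.
have [P [Pl MP] Po] := orthogonal_projection (tensor_subspace_closed t A setT).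
(* The projection onto A (x) K is [PA] (x) 1: the difference [q] lies in A (x) K and is orthogonal
   to it. *)
have Pxy x y : P (t x y) = t (PA x) y.
  have MPA : tensor_subspace t A setT (t (PA x) y) by apply: mem_tensor_subspace.
  apply/eqP; rewrite -subr_eq0; apply/eqP/sqn_eq0.
  set q := _ - _; have Mq : tensor_subspace t A setT q.
    exact: (closed_subspaceB (tensor_subspace_closed t A setT) (MP _) MPA).
  have : inner L ((t x y - t (PA x) y) - (t x y - P (t x y))) q = 0.
    rewrite linearBl /= Po // subr0 -tensBl.
    apply: innerC0; move: (q) Mq.
    apply: (tensor_subspace_ind (closed_subspace_orth (t (x - PA x) y))).
    move=> x' y' Ax' _ /=; rewrite inner_tens.
    by rewrite (innerC0 (PAo _ _ Ax')) mul0r.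
  by rewrite opprB [X in inner L X q]addrC subrKA /sqn => ->.
have PB : tensor_subspace t A B (P n).
  apply: (tensor_subspace_ind (M := P @^-1` tensor_subspace t A B)) Bn.
    by apply: closed_subspace_preimage => //; apply: tensor_subspace_closed.
  by move=> x y _ By /=; rewrite Pxy; apply: mem_tensor_subspace.
(* Split [z - P n] orthogonally into [z - P z] and [P (z - n)]. The first is no longer than [z - m],
   because [P z] is the best approximation, and the second no longer than [z - n]. *)
exists (P n) => //.
have sqP x : sqn (P x) <= sqn x.
  by rewrite -{2}(subrK (P x) x) sqnD_orth ?lerDr ?sqn_ge0 ?Po //.
have -> : z - P n = (z - P z) + P (z - n).
  by rewrite (linear_sub Pl.1) subrKA.
rewrite sqnD_orth ?Po //; apply: lerD => //.
have -> : z - m = (z - P z) + (P z - m) by rewrite subrKA.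
rewrite (sqnD_orth (x := z - P z)) ?lerDl ?sqn_ge0 // Po //.
exact: (closed_subspaceB (tensor_subspace_closed t A setT)).
Qed.

End Tensor.

(** * Units *)

(** The lower limit of the sets [N h] as [h] tends to 0 from the right; no monotonicity in [h] is
    built in. *)
Definition near_family H (N : {nonneg R} -> set H) : set H :=
  [set x | forall e : R, 0 < e -> exists2 d : R, 0 < d &
    forall h : {nonneg R}, 0 < h%:num -> h%:num < d ->
      exists2 m, N h m & sqn (x - m) < e].

Lemma near_family_closed H (N : {nonneg R} -> set H) :
  (forall h, N h 0) ->
  (forall h a x y, N h x -> N h y -> N h (a *: x + y)) ->
  closed_subspace (near_family N).
Proof.
move=> N0 Nl; split=> /=.
- by move=> e e0; exists 1 => // h _ _; exists 0 => //; rewrite subrr sqn0.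
- move=> a x y Nx Ny e e0.
  have a0 : 0 < csq a + 1 by rewrite ltr_wpDl ?csq_ge0.
  have [|d1 d10 xd] := Nx (e / 4 / (csq a + 1)); first by rewrite !divr_gt0.
  have [|d2 d20 yd] := Ny (e / 4); first by rewrite divr_gt0.
  exists (Num.min d1 d2); first by rewrite lt_min d10.
  move=> h h0; rewrite lt_min => /andP[/(xd h h0)[m Nm xm] /(yd h h0)[n Nn yn]].
  exists (a *: m + n); first exact: Nl.
  rewrite opprD addrACA -scalerBr.
  apply: le_lt_trans (sqnD_le _ _) _; rewrite sqnZ.
  have : csq a * sqn (x - m) <= e / 4.
    rewrite ltr_pdivlMr // mulrC in xm; apply: le_trans (ltW xm).
    by rewrite ler_wpM2r ?sqn_ge0 // lerDl.
  by move: yn; lra.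
apply/closed_sqnP => x xN /= e e0.
have [|y Ny xy] := xN (e / 4); first by rewrite divr_gt0.
have [|d d0 yd] := Ny (e / 4); first by rewrite divr_gt0.
exists d => // h h0 /(yd h h0)[m Nm ym]; exists m => //.
by apply: le_lt_trans (sqnB_trans y _ _) _; move: xy ym; lra.
Qed.

Lemma nonneg_ex (a : R) : 0 <= a -> exists c : {nonneg R}, c%:num = a.
Proof. by move=> a0; exists (NngNum a0). Qed.

Lemma nonneg_sub (a b : {nonneg R}) :
  a%:num <= b%:num -> exists c : {nonneg R}, b%:num = a%:num + c%:num.
Proof.
rewrite -subr_ge0 => /nonneg_ex[c cE].
by exists c; rewrite cE addrC subrK.
Qed.

Section Units.
Variables (E : arveson R) (u : forall t, E t).
Hypothesis uu : normalised_unit u.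

Lemma sqn_unit t : sqn (u t) = 1.
Proof.
case: uu => _ /(_ t) u1 _; apply: complexI.
by rewrite -norm_sqn u1 expr1n.
Qed.

Lemma unitD (s t r : {nonneg R}) (h : r%:num = s%:num + t%:num) :
  u r = pmul h (u s) (u t).
Proof. by case: uu. Qed.

(* The closed subspace of the x satisfying the conclusion contains all the
   u_h (x) E_{r-h}; a vector orthogonal to it is excluded by separability. *)
Lemma unit_tens_near0 (r : {nonneg R}) (x : E r) : 0 < r%:num ->
  forall e : R, 0 < e -> exists2 d : R, 0 < d &
    forall (h k : {nonneg R}) (hk : r%:num = h%:num + k%:num),
      0 < h%:num -> h%:num < d ->
      exists y, sqn (x - pmul hk (u h) y) < e.
Proof.
(* Quantifying over [k] avoids choosing [r - h]. For [h] beyond [r] no [k] exists and [N h] is the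
   whole fibre. *)
move=> r0; pose N (h : {nonneg R}) : set (E r) := [set m |
  forall (k : {nonneg R}) (hk : r%:num = h%:num + k%:num), exists y, m = pmul hk (u h) y].
have cW : closed_subspace (near_family N).
  apply: near_family_closed => [h k hk|h a y z Ny Nz k hk].
    by exists 0; rewrite (tensr0 (pmul_tensor E hk)).
  have [[y' ->] [z' ->]] := (Ny k hk, Nz k hk).
  by exists (a *: y' + z'); rewrite (tensPr (pmul_tensor E hk)).
(* For h' <= h the factor u_h splits as u_h' (x) u_{h-h'}, so the vector itself lies in [N h']. *)
have uW h k (hk : r%:num = h%:num + k%:num) a : 0 < h%:num ->
    near_family N (pmul hk (u h) a).
  move=> h0 e e0; exists h%:num => // h' h'0 h'h.
  exists (pmul hk (u h) a); last by rewrite subrr sqn0.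
  move=> k' hk'; have [l hl] := nonneg_sub (ltW h'h).
  have hk'' : k'%:num = l%:num + k%:num by move: hk hk' hl; lra.
  by exists (pmul hk'' (u l) a); rewrite (pmulA hl hk'' hk hk') -unitD.
suff WT : near_family N = setT.
  have : near_family N x by rewrite WT.
  move=> xN e /xN[d d0 dP]; exists d => // h k hk h0 /(dP h h0)[m Nm xm].
  by have [y mE] := Nm k hk; exists y; rewrite -mE.
apply: closed_subspace_total => // y yW; apply: sqn_eq0.
apply/eqP; rewrite eq_le sqn_ge0 andbT leNgt; apply/negP => y0.
(* The vectors u_s (x) y (x) u_{1-s} all live in the single fibre at time r + 1; outside [0, 1] the
   value 0 is a dummy. *)
have [T TE] := nonneg_ex (addr_ge0 (ltW r0) ler01).
have /choice[Y YP] : forall s : R, exists Y : E T, 0 <= s <= 1 ->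
    exists s1 t1 q (h1 : q%:num = r%:num + t1%:num) (h2 : T%:num = s1%:num + q%:num),
      s1%:num = s /\ Y = pmul h2 (u s1) (pmul h1 y (u t1)).
  move=> s; have [s01|] := boolP (0 <= s <= 1); last by exists 0.
  have [s0 s1] := andP s01.
  have [s1' s1E] := nonneg_ex s0.
  have [|t1 t1E] := nonneg_ex (a := 1 - s); first by rewrite subr_ge0.
  have [|q qE] := nonneg_ex (a := r%:num + t1%:num); first by rewrite addr_ge0.
  have h2 : T%:num = s1'%:num + q%:num by rewrite TE qE t1E s1E; ring.
  by exists (pmul h2 (u s1') (pmul qE y (u t1))) => _; exists s1', t1, q, qE, h2.
apply: (no_uncountable_orthogonal (y := Y) y0) => // [s|s t s0 st t1].
  move=> /YP[s1 [t1 [q [h1 [h2 [_ ->]]]]]].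
  rewrite (sqn_tens (pmul_tensor E h2)) (sqn_tens (pmul_tensor E h1)).
  by rewrite !sqn_unit mulr1 mul1r.
have [|s1 [t1' [q [h1 [h2 [s1E ->]]]]]] := YP s; first by apply/andP; split; lra.
have [|s2 [t2 [q' [h1' [h2' [s2E ->]]]]]] := YP t; first by apply/andP; split; lra.
have [|d hd] := nonneg_sub (a := s1) (b := s2); first by rewrite s1E s2E ltW.
have d0 : 0 < d%:num by move: hd; rewrite s1E s2E; lra.
have hq : q%:num = d%:num + q'%:num by move: h2 h2' hd; lra.
move: (pmul h1' y (u t2)) => z'.
rewrite (unitD hd) -(pmulA hd hq h2' h2) (inner_tens (pmul_tensor E h2)).
(* After cancelling the common initial u_s, compare y (x) u_{1-s} with a vector beginning with u_d,
   where d = t - s. On the first [h] units of time, [h] being the minimum of [d] and [r], the second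
   vector is u_h while the first is still inside [y]. *)
have [|h hE] := nonneg_ex (a := Num.min d%:num r%:num); first by rewrite le_min !ltW.
have h0 : 0 < h%:num by rewrite hE lt_min d0.
have [|d1 hd1] := nonneg_sub (a := h) (b := d); first by rewrite hE ge_min lexx.
have [|r1 hr1] := nonneg_sub (a := h) (b := r); first by rewrite hE ge_min lexx orbT.
have [|w hw] := nonneg_ex (a := d1%:num + q'%:num); first by rewrite addr_ge0.
have hq2 : q%:num = h%:num + w%:num by move: hq hw hd1; lra.
have hw2 : w%:num = r1%:num + t1'%:num by move: hq2 h1 hr1; lra.
rewrite (unitD hd1) -(pmulA hd1 hw hq hq2).
apply/eqP; rewrite mulf_eq0; apply/orP; right; apply/eqP.
(* The rest of the second vector may be arbitrary. Cutting it where [y] ends, an elementary tensor a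
   (x) b yields the factor <y, u_h (x) a> = 0. *)
apply: innerC0; move: (pmul hw _ _).
apply: (tens_ind (pmul_tensor E hw2)) => [|a b].
  exact: (closed_subspace_preimage (bounded_linear_tensr (pmul_tensor E hq2) (u h))
    (closed_subspace_orth _)).
rewrite (pmulA hr1 hw2 h1 hq2) (inner_tens (pmul_tensor E h1)).
by rewrite (innerC0 (yW _ (uW _ _ hr1 a h0))) mul0r.
Qed.

(** This moves the approximation from the start of the interval to time [b]: for an elementary
    tensor a (x) z it suffices to approximate [z], with the error scaled by |a|^2. *)
Lemma unit_tens_near (b c T : {nonneg R}) (hT : T%:num = b%:num + c%:num) (x : E T) :
  0 < c%:num -> forall e : R, 0 < e -> exists2 d : R, 0 < d &
    forall (h r : {nonneg R}) (hr : c%:num = h%:num + r%:num),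
      0 < h%:num -> h%:num < d ->
      exists2 m, tensor_subspace (pmul hT) setT (range (pmul hr (u h))) m &
        sqn (x - m) < e.
Proof.
move=> c0; pose N (h : {nonneg R}) : set (E T) := [set m |
  forall (r : {nonneg R}) (hr : c%:num = h%:num + r%:num),
    tensor_subspace (pmul hT) setT (range (pmul hr (u h))) m].
have cW : closed_subspace (near_family N).
  apply: near_family_closed => [h r hr|h a y z Ny Nz r hr].
    by case: (tensor_subspace_closed (pmul hT) setT (range (pmul hr (u h)))).
  have [_ lM _] := tensor_subspace_closed (pmul hT) setT (range (pmul hr (u h))).
  by apply: lM; [apply: Ny|apply: Nz].
suff : near_family N x.
  move=> xN e /xN[d d0 dP]; exists d => // h r hr h0 /(dP h h0)[m Nm xm].
  by exists m => //; apply: Nm.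
apply: (tens_ind (pmul_tensor E hT)) => // a z e e0.
have a0 : 0 < sqn a + 1 by rewrite ltr_wpDl ?sqn_ge0.
have [|d d0 dP] := unit_tens_near0 z c0 (e := e / (sqn a + 1)).
  by rewrite divr_gt0.
exists (Num.min d c%:num); first by rewrite lt_min d0.
move=> h h0; rewrite lt_min => /andP[hd hc].
have [r hr] := nonneg_sub (ltW hc).
have [y zy] := dP h r hr h0 hd.
exists (pmul hT a (pmul hr (u h) y)).
  (* The remaining time is determined by [h], and the proofs of the time equations are unique. *)
  move=> r' hr'; have rr : r = r' by apply/val_inj; move: (hr) (hr') => /= -> /addrI.
  move: hr'; rewrite -rr => hr'; rewrite (eq_irrelevance hr' hr).
  by apply: mem_tensor_subspace => //; exists y.
rewrite -(tensBr (pmul_tensor E hT)) (sqn_tens (pmul_tensor E hT)).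
rewrite ltr_pdivlMr // mulrC in zy; apply: le_lt_trans zy.
by rewrite ler_wpM2r ?sqn_ge0 // lerDl.
Qed.

End Units.

(* g T0 <= g (n h) = (g h)^n with n h close to T0, and n (1 - q) q^n <= 1. *)
Lemma multiplicative_linear_bound (g : R -> R) (T0 : R) :
  (forall h : R, 0 < h -> 0 <= g h <= 1) ->
  (forall s t : R, 0 < s -> 0 < t -> g (s + t) = g s * g t) ->
  0 < T0 -> 0 < g T0 ->
  exists2 C, 0 < C & forall h : R, 0 < h -> 1 - g h <= C * h.
Proof.
move=> g01 gD T00 gT0.
have gX (h : R) n : 0 < h -> g (h *+ n.+1) = g h ^+ n.+1.
  move=> h0; elim: n => [|n IH]; first by rewrite mulr1n expr1.
  by rewrite mulrS gD ?IH -?exprS // pmulrn_lgt0.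
exists (2 / (T0 * g T0)) => [|h h0]; first by rewrite divr_gt0 ?mulr_gt0.
have [gh0 gh1] := andP (g01 h h0).
have [_ gT1] := andP (g01 T0 T00).
rewrite mulrAC ler_pdivlMr ?mulr_gt0 //.
have [Th|hT] := ltP T0 h.
  have : (1 - g h) * (T0 * g T0) <= 1 * (T0 * 1).
    by apply: ler_pM; rewrite ?subr_ge0 ?mulr_ge0 ?(ltW gT0) ?(ltW T00) //;
       [lra|rewrite ler_wpM2l // ltW].
  lra.
(* With [n] the integer part of T0 / h, which is at least 1, one has n h <= T0 < (n + 1) h <= 2 n h.
   This is the source of the 2 in the constant. *)
have /andP[nT Tn] := truncn_itv (divr_ge0 (ltW T00) (ltW h0)).
set n := Num.truncn _ in nT Tn.
rewrite ler_pdivlMr // in nT; rewrite ltr_pdivrMr // in Tn.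
have n0 : (0 < n)%N.
  rewrite lt0n; apply/negP => /eqP n0; move: Tn hT; rewrite n0; lra.
case: n n0 nT Tn => // n _ nT Tn.
have gTn : g T0 <= g h ^+ n.+1.
  rewrite -gX //; move: nT; rewrite le_eqVlt mulr_natl => /orP[/eqP -> //|nT].
  have hn : 0 < h *+ n.+1 by rewrite pmulrn_lgt0.
  rewrite -(subrK (h *+ n.+1) T0) gD ?subr_gt0 //.
  have [_ g1] := andP (g01 (T0 - h *+ n.+1) (eq_ind_r _ nT (subr_gt0 _ _))).
  by rewrite ler_piMl // (andP (g01 _ hn)).1.
(* For q = g h in [0, 1], each of the k + 1 terms of 1 + q + ... + q^k is at least q^(k+1). *)
have gB k : g h ^+ k.+1 * (k.+1%:R * (1 - g h)) <= 1 - g h ^+ k.+1.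
  elim: k => [|k IH]; first by rewrite expr1 mul1r; nra.
  have : 0 <= g h ^+ k.+1 <= 1 by rewrite exprn_ge0 ?exprn_ile1.
  rewrite (exprS _ k.+1) -(natr1 k.+1).
  move: (g h ^+ k.+1) (k.+1%:R : R) IH => Q m IH /andP[Q0 Q1].
  have : g h * (Q * (m * (1 - g h))) <= g h * (1 - Q) by rewrite ler_wpM2l.
  have : 0 <= (1 - g h) * (1 - g h * Q).
    by apply: mulr_ge0; rewrite subr_ge0 //; apply: mulr_ile1.
  by lra.
have : g T0 * (n.+1%:R * (1 - g h)) <= 1.
  apply: le_trans (_ : 1 - g h ^+ n.+1 <= 1); last by rewrite gerBl exprn_ge0.
  apply: le_trans (gB n); rewrite ler_wpM2r // mulr_ge0 // subr_ge0 //.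
have : T0 <= 2 * (n.+1%:R * h).
  apply: le_trans (ltW Tn) _; rewrite mulrA ler_wpM2r ?(ltW h0) //.
  by rewrite -natrM ler_nat mul2n -addnn addSn ltnS leq_addl.
move=> T2 gn.
have : (1 - g h) * (T0 * g T0) <= (1 - g h) * (2 * (n.+1%:R * h) * g T0).
  by apply: ler_wpM2l; rewrite ?subr_ge0 ?ler_wpM2r ?(ltW gT0).
have : h * (g T0 * (n.+1%:R * (1 - g h))) <= h * 1 by rewrite ler_wpM2l // ltW.
move: (n.+1%:R : R) => m; nra.
Qed.

(** * The overlap of two units *)

Lemma sqn_sub_overlap (F : arveson R) (v v' : forall t, F t) h :
  normalised_unit v -> normalised_unit v' ->
  sqn (v' h - inner (F h) (v' h) (v h) *: v h) =
    1 - csq (inner (F h) (v' h) (v h)).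
Proof.
move=> uv uv'; have := sqn_sub_proj (v' h) (y := v h).
by rewrite (sqn_unit uv) (sqn_unit uv') !divr1; apply; rewrite oner_neq0.
Qed.

(** The squared overlap is multiplicative in time with values in [0, 1], so
    [multiplicative_linear_bound] applies once it is nonzero at one positive time. *)
Lemma unit_overlap_bound (F : arveson R) (v v' : forall t, F t) :
  normalised_unit v -> normalised_unit v' ->
  exists2 C : R, 0 < C & forall h : {nonneg R}, 0 < h%:num ->
    1 - csq (inner (F h) (v' h) (v h)) <= C * h%:num.
Proof.
move=> uv uv'.
pose f (h : {nonneg R}) := csq (inner (F h) (v' h) (v h)).
have f1 h : f h <= 1.
  by rewrite -subr_ge0 -(sqn_sub_overlap _ uv uv') sqn_ge0.
have fD (s t r : {nonneg R}) : r%:num = s%:num + t%:num -> f r = f s * f t.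
  move=> h; rewrite /f (unitD uv h) (unitD uv' h) (inner_tens (pmul_tensor F h)).
  exact: csqM.
have [one oneE] := nonneg_ex (ler01 : 0 <= 1 :> R).
have one0 : 0 < one%:num by rewrite oneE.
have [d d0 dP] := unit_tens_near0 uv (v' one) one0 (ltr01 : 0 < 1 :> R).
have [T T0 TT] : exists2 T : {nonneg R}, 0 < T%:num & 0 < f T.
  have m0 : 0 < Num.min d 1 / 2 by rewrite divr_gt0 // lt_min d0 ltr01.
  have [h hE] := nonneg_ex (ltW m0).
  have [md m1] : Num.min d 1 <= d /\ Num.min d 1 <= 1.
    by rewrite !ge_min !lexx orbT.
  have [|k hk] := nonneg_sub (a := h) (b := one); first by rewrite hE oneE; lra.
  have [||y] := dP h k hk; rewrite ?hE //; first by lra.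
  rewrite sqnB (sqn_unit uv') => vy.
  exists h; first by rewrite hE.
  rewrite lt_neqAle csq_ge0 andbT eq_sym; apply/eqP => /csq_eq0 f0.
  (* Zero overlap at [h] would make v'_1 orthogonal to v_h (x) y, hence at squared distance at least
     1 from it, against the choice of [y]. *)
  have vo : inner (F one) (v' one) (pmul hk (v h) y) = 0.
    by rewrite (unitD uv' hk) (inner_tens (pmul_tensor F hk)) f0 mul0r.
  have re0 : complex.Re (inner (F one) (v' one) (pmul hk (v h) y)) = 0 by rewrite vo.
  by move: vy; rewrite re0; have := sqn_ge0 (pmul hk (v h) y); lra.
have fnum (h : {nonneg R}) : f (`|h%:num|%:nng) = f h.
  by congr f; apply/val_inj; rewrite /= ger0_norm.
have [|||C C0 CP] :=
    multiplicative_linear_bound (g := fun h : R => f (`|h|%:nng)) _ _ T0.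
- by move=> h _; rewrite csq_ge0 f1.
- by move=> s t s0 t0; apply: fD => /=; rewrite !gtr0_norm // addr_gt0.
- by rewrite fnum.
by exists C => // h /CP; rewrite fnum.
Qed.

(* P s e means phi s <= e for a function phi with right derivative at most 0. *)
Lemma continuous_induction (P : R -> R -> Prop) (A T : R) : 0 <= A ->
  (forall s e e', e <= e' -> P s e -> P s e') ->
  (forall s, 0 < s < T -> P s (A * s)) ->
  (forall s s' e, 0 < s -> s < s' -> s' < T -> P s e -> P s' (e + A * (s' - s))) ->
  (forall s eta, 0 < s < T -> 0 < eta -> exists2 d, 0 < d &
    forall s' e, s < s' -> s' < T -> s' < s + d -> P s e ->
      P s' (e + eta * (s' - s))) ->
  forall t eta, 0 < t < T -> 0 < eta -> P t eta.
Proof.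
move=> A0 Pmono Pstart Pstep Pright.
have Pt t eta : 0 < t < T -> 0 < eta -> P t (eta * (1 + t) + eta).
  move=> /andP[t0 tT] eta0.
  (* The aim is sup B = t. The base point of [B] comes from the bound [A * s] near 0. *)
  pose B := [set s | [/\ 0 < s, s <= t & P s (eta * (1 + s))]].
  have B0 : B !=set0.
    have A1 : 0 < A + 1 by lra.
    have s0 : 0 < Num.min t (eta / (A + 1)) by rewrite lt_min t0 divr_gt0.
    have [st sA] : Num.min t (eta / (A + 1)) <= t /\
        Num.min t (eta / (A + 1)) <= eta / (A + 1).
      by rewrite !ge_min !lexx orbT.
    exists (Num.min t (eta / (A + 1))); split=> //.
    move: (Num.min _ _) s0 st sA => s s0 st sA.
    apply: Pmono (Pstart s _); last by apply/andP; split; lra.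
    rewrite ler_pdivlMr // in sA.
    have : 0 <= eta * s by rewrite mulr_ge0 // ltW.
    by lra.
  have Bt : ubound B t by move=> s [].
  have hB : has_sup B by split=> //; exists t.
  have [b Bb] := B0.
  have ssup s : B s -> s <= sup B by move=> Bs; apply: ub_le_sup => //; exists t.
  have sup0 : 0 < sup B by apply: lt_le_trans (ssup b Bb); case: Bb.
  have supt : sup B <= t by apply: ge_sup.
  (* The Lipschitz step from a point of [B] just below the supremum costs an arbitrarily small
     [e]. *)
  have near_sup e : 0 < e -> P (sup B) (eta * (1 + sup B) + e).
    move=> e0; have A1 : 0 < A + 1 by lra.
    have [|s Bs] := @sup_adherent _ B (e / (A + 1)) _ hB; first by rewrite divr_gt0.
    have [s0 st Ps] := Bs; have := ssup s Bs.
    rewrite ltrBlDr -ltrBlDl ltr_pdivlMr // le_eqVlt => /orP[/eqP sE _|ss se].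
      by rewrite -sE; apply: Pmono Ps; lra.
    apply: Pmono (Pstep s (sup B) _ _ _ _ Ps) => //; last by lra.
    have : 0 <= eta * (sup B - s) by rewrite mulr_ge0 ?subr_ge0 // ltW.
    by lra.
  move: supt; rewrite le_eqVlt => /orP[/eqP <-|supt]; first exact: near_sup.
  have [||d d0 dP] := Pright (sup B) (eta / 2); first by apply/andP; split; lra.
    by rewrite divr_gt0.
  (* Going beyond the supremum at rate [eta / 2] leaves [eta / 2 * (s - sup B)] to pay for the slack
     [e] at the supremum. Thus [s] lies in [B], a contradiction. *)
  pose s := Num.min t (sup B + d / 2).
  have d2 : 0 < d / 2 by rewrite divr_gt0.
  have [st sd] : s <= t /\ s <= sup B + d / 2 by rewrite !ge_min !lexx orbT.
  have ss : sup B < s by rewrite lt_min supt ltrDl.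
  have : B s.
    split=> //; first by lra.
    have h0 : 0 < eta / 2 * (s - sup B) by rewrite mulr_gt0 ?divr_gt0 // subr_gt0.
    apply: Pmono (dP s _ _ _ _ (near_sup _ h0)); lra.
  by move=> /ssup; lra.
move=> t eta /andP[t0 tT] eta0.
have t2 : 0 < 2 + t by lra.
have e0 : 0 < eta / (2 + t) by rewrite divr_gt0.
apply: Pmono (Pt t _ _ e0); last by apply/andP.
have : eta / (2 + t) * (2 + t) = eta by rewrite divfK // gt_eqF.
by lra.
Qed.

(** * The spatial product *)

Section Main.
Variables (E F : arveson R) (EF : tensor_system E F).
Variables (u : forall t, E t) (v v' : forall t, F t).
Hypotheses (uu : normalised_unit u) (uv : normalised_unit v)
  (uv' : normalised_unit v').
Variable S : forall t, set (EF t).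
Hypothesis sS : subsystem S.
Hypothesis Su : forall t, 0 < t%:num -> forall y, S (tens EF (u t) y).
Hypothesis Sv : forall t, 0 < t%:num -> forall x, S (tens EF x (v t)).

Let f (h : {nonneg R}) := inner (F h) (v' h) (v h).
Let w h := v' h - f h *: v h.
Let sqn_w h : sqn (w h) = 1 - csq (f h).
Proof. exact: sqn_sub_overlap. Qed.

Let cS t : closed_subspace (S (t:=t)).
Proof. by case: sS. Qed.

Let S_pmul s t r (h : r%:num = s%:num + t%:num) x y :
  S (t := s) x -> S (t := t) y -> S (pmul h x y).
Proof.
by move=> Sx Sy; case: sS => _ /(_ _ _ _ h) <- _; apply: mem_tensor_subspace.
Qed.

Let ET t := tens_tensor EF t.

Variable T : {nonneg R}.
Variable x : E T.
Let z := tens EF x (v' T).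

(** Replacing v'_s by its component along v_s on the first interval puts that part in E (x) v. This
    starts the induction near time 0. *)
Lemma first_piece (s r : {nonneg R}) (h : T%:num = s%:num + r%:num) : 0 < s%:num ->
  exists2 m, tensor_subspace (pmul h) (@S s) setT m &
    sqn (z - m) = sqn x * (1 - csq (f s)).
Proof.
move=> s0; exists (tens EF x (pmul h (f s *: v s) (v' r))).
  move: x; apply: (tens_ind (pmul_tensor E h)) => [|a b].
    exact: (closed_subspace_preimage (bounded_linear_tensl (ET T) _)
      (tensor_subspace_closed _ _ _)).
  rewrite -tens_pmul (tensZr (ET s)); apply: mem_tensor_subspace => //.
  by apply: closed_subspaceZ; [apply: cS|apply: Sv].
rewrite /z -(tensBr (ET T)) (unitD uv' h) -(tensBl (pmul_tensor F h)).
by rewrite (sqn_tens (ET T)) (sqn_tens (pmul_tensor F h)) (sqn_unit uv') mulr1 sqn_w.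
Qed.

(** The same replacement on the last interval, combined with [m] by the commuting projections, lands
    in [S] over the whole of [0, T]. *)
Lemma last_piece (b h : {nonneg R}) (hT : T%:num = b%:num + h%:num) m :
  0 < h%:num -> tensor_subspace (pmul hT) (@S b) setT m ->
  exists2 p, S p & sqn (z - p) <= sqn (z - m) + sqn x * (1 - csq (f h)).
Proof.
move=> h0 Sm.
pose n := tens EF x (pmul hT (v' b) (f h *: v h)).
have Sn : tensor_subspace (pmul hT) setT (@S h) n.
  rewrite /n; move: x; apply: (tens_ind (pmul_tensor E hT)) => [|a c].
    exact: (closed_subspace_preimage (bounded_linear_tensl (ET T) _)
      (tensor_subspace_closed _ _ _)).
  rewrite -tens_pmul (tensZr (ET h)); apply: mem_tensor_subspace => //.
  by apply: closed_subspaceZ; [apply: cS|apply: Sv].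
have [p Sp zp] := tensor_subspace_dist (pmul_tensor EF hT) z (cS b) Sm Sn.
exists p; first by case: sS => _ /(_ _ _ _ hT) <- _.
suff <- : sqn (z - n) = sqn x * (1 - csq (f h)) by [].
rewrite /z -(tensBr (ET T)) (unitD uv' hT) -(tensBr (pmul_tensor F hT)).
by rewrite (sqn_tens (ET T)) (sqn_tens (pmul_tensor F hT)) (sqn_unit uv') mul1r sqn_w.
Qed.

Lemma next_piece (b h r bh c : {nonneg R}) (hbh : bh%:num = b%:num + h%:num)
    (hc : c%:num = h%:num + r%:num) (hTr : T%:num = bh%:num + r%:num)
    (hTc : T%:num = b%:num + c%:num) m x' :
  0 < h%:num -> tensor_subspace (pmul hTc) (@S b) setT m ->
  tensor_subspace (pmul hTc) setT (range (pmul hc (u h))) x' ->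
  exists2 p, tensor_subspace (pmul hTr) (@S bh) setT p &
    sqn (z - p) <= sqn (z - m) + sqn (x - x') * (1 - csq (f h)).
Proof.
move=> h0 Sm x'u.
pose N := tensor_subspace (pmul hc) (@S h) setT.
pose vb y := pmul hTc (v' b) (pmul hc y (v' r)).
have vbl y y' : vb (y - y') = vb y - vb y'.
  by rewrite /vb (tensBl (pmul_tensor F hc)) (tensBr (pmul_tensor F hTc)).
have sqn_vb y : sqn (vb y) = sqn y.
  rewrite (sqn_tens (pmul_tensor F hTc)) (sqn_tens (pmul_tensor F hc)).
  by rewrite !(sqn_unit uv') mul1r mulr1.
have cN := tensor_subspace_closed (pmul hTc) setT N.
(* Over the new interval the first summand carries v_h, and the second carries u_h in E and w_h in
   F; both lie in [S] there. The error [z - n] is (x - x') tensored with [vb (w h)]. *)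
pose n := tens EF x (vb (f h *: v h)) + tens EF x' (vb (w h)).
have Nn : tensor_subspace (pmul hTc) setT N n.
  apply: (closed_subspaceD cN).
    move: x; apply: (tens_ind (pmul_tensor E hTc)) => [|a].
      exact: (closed_subspace_preimage (bounded_linear_tensl (ET T) _) cN).
    rewrite /vb; apply: (tens_ind (pmul_tensor E hc)) => [|d e].
      exact: (closed_subspace_preimage (bounded_linear_tensr (pmul_tensor E hTc) a)
        (closed_subspace_preimage (bounded_linear_tensl (ET T) _) cN)).
    rewrite -!tens_pmul; apply: mem_tensor_subspace => //.
    apply: mem_tensor_subspace => //.
    rewrite (tensZr (ET h)).
    by apply: closed_subspaceZ; [apply: cS|apply: Sv].
  apply: (tensor_subspace_ind (M := [set x' | tensor_subspace (pmul hTc) setT N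
    (tens EF x' (vb (w h)))])) x'u => [|a _ _ [y _ <-]] /=.
    exact: (closed_subspace_preimage (bounded_linear_tensl (ET T) _) cN).
  rewrite -!tens_pmul; apply: mem_tensor_subspace => //; apply: mem_tensor_subspace => //.
  exact: Su.
have [p Sp zp] := tensor_subspace_dist (pmul_tensor EF hTc) z (cS b) Sm Nn.
(* Regroup by associativity: S_b (x) S_h is contained in S_{b+h}. *)
exists p.
  move: Sp; apply: tensor_subspace_ind; first exact: tensor_subspace_closed.
  move=> a y Sa.
  apply: (tensor_subspace_ind (M := [set y | tensor_subspace (pmul hTr) (@S bh) setT
    (pmul hTc a y)])) => [|s y' Ss _] /=.
    exact: (closed_subspace_preimage (bounded_linear_tensr (pmul_tensor EF hTc) a)
      (tensor_subspace_closed _ _ _)).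
  by rewrite (pmulA hbh hc hTr hTc); apply: mem_tensor_subspace => //; apply: S_pmul.
suff <- : sqn (z - n) = sqn (x - x') * (1 - csq (f h)) by [].
have -> : z - n = tens EF (x - x') (vb (w h)).
  rewrite (tensBl (ET T)) /n opprD addrA /z; congr (_ - _).
  by rewrite (unitD uv' hTc) (unitD uv' hc) -(tensBr (ET T)) -vbl.
by rewrite (sqn_tens (ET T)) sqn_vb sqn_w.
Qed.

Lemma tens_unit_mem : 0 < T%:num -> S z.
Proof.
move=> T0; have [C C0 qC] := unit_overlap_bound uv uv'.
(* This bounds the squared distance phi(s) by [e] through a witness, without forming an infimum. *)
pose P (s e : R) := exists (b r : {nonneg R}) (h : T%:num = b%:num + r%:num) m,
  [/\ b%:num = s, tensor_subspace (pmul h) (@S b) setT m & sqn (z - m) <= e].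
have A0 : 0 <= sqn x * C by rewrite mulr_ge0 ?sqn_ge0 // ltW.
have xq (h : {nonneg R}) : 0 < h%:num ->
    sqn x * (1 - csq (f h)) <= sqn x * C * h%:num.
  by move=> h0; rewrite -mulrA ler_wpM2l ?sqn_ge0 ?qC.
(* Used twice: with x' = 0 for the Lipschitz bound, and with x' close to [x] for the vanishing right
   derivative. *)
have next (s s' e eta : R) : 0 < s -> s < s' -> s' < T%:num ->
    (forall (b c h r : {nonneg R}) (hTc : T%:num = b%:num + c%:num)
        (hc : c%:num = h%:num + r%:num), b%:num = s -> h%:num = s' - s ->
      exists2 x', tensor_subspace (pmul hTc) setT (range (pmul hc (u h))) x' &
        sqn (x - x') * (1 - csq (f h)) <= eta) ->
    P s e -> P s' (e + eta).
  move=> s0 ss' s'T near_x [b [c [hTc [m [bs Sm zm]]]]].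
  have [|h hE] := nonneg_ex (a := s' - s); first by rewrite subr_ge0 ltW.
  have [|r hc] := nonneg_sub (a := h) (b := c); first by rewrite hE; lra.
  have [|bh bhE] := nonneg_ex (a := s'); first by lra.
  have hbh : bh%:num = b%:num + h%:num by rewrite bs hE bhE; ring.
  have hTr : T%:num = bh%:num + r%:num by lra.
  have [x' x'u xx'] := near_x b c h r hTc hc bs hE.
  have [|p Sp zp] := next_piece hbh hTr _ Sm x'u; first by rewrite hE subr_gt0.
  by exists bh, r, hTr, p; split=> //; apply: le_trans zp _; apply: lerD.
have Pt : forall t eta, 0 < t < T%:num -> 0 < eta -> P t eta.
  apply: (continuous_induction A0).
  - by move=> s e e' ee' [b [r [h [m [bs Sm zm]]]]]; exists b, r, h, m; split=> //; lra.
  - move=> s /andP[s0 sT]; have [b bs] := nonneg_ex (ltW s0).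
    have [|r h] := nonneg_sub (a := b) (b := T); first by rewrite bs ltW.
    have b0 : 0 < b%:num by rewrite bs.
    have [m Sm zm] := first_piece h b0.
    by exists b, r, h, m; split=> //; rewrite zm -bs xq.
  - move=> s s' e s0 ss' s'T; apply: next => // b c h r hTc hc bs hE.
    exists 0.
      by case: (tensor_subspace_closed (pmul hTc) setT (range (pmul hc (u h)))).
    by rewrite subr0 -hE xq // hE subr_gt0.
  move=> s eta /andP[s0 sT] eta0.
  have [b bs] := nonneg_ex (ltW s0).
  have [|c hTc] := nonneg_sub (a := b) (b := T); first by rewrite bs ltW.
  have c0 : 0 < c%:num by lra.
  (* The error [eta / C] for [x], times the bound [C * h] for |w_h|^2, gives [eta * h]. *)
  have [|d d0 dP] := unit_tens_near uu hTc x c0 (e := eta / C); first by rewrite divr_gt0.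
  exists d => // s' e ss' s'T s'd; apply: next => // b' c' h r hTc' hc b's hE.
  have bb : b' = b by apply/val_inj; rewrite /= b's bs.
  have cc : c' = c by apply/val_inj; move: (hTc) (hTc'); rewrite bb => /= -> /addrI.
  move: hTc' hc; rewrite bb cc => hTc' hc; rewrite (eq_irrelevance hTc' hTc).
  have [||x' x'u xx'] := dP h r hc; rewrite ?hE ?subr_gt0 //; first by lra.
  exists x' => //; rewrite -hE; apply: le_trans (_ : eta / C * (C * h%:num) <= _).
    have h0 : 0 < h%:num by rewrite hE subr_gt0.
    by apply: ler_pM; rewrite ?sqn_ge0 ?qC ?(ltW xx') // -sqn_w sqn_ge0.
  by rewrite mulrA divfK // gt_eqF.
apply: ((closed_sqnP _).1 _) => [|e e0]; first by case: (cS T).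
have A1 : 0 < sqn x * C + 1 by lra.
(* The induction stops short of [T]. The last interval has length [d], small enough to cost less
   than [e / 2]; halving makes both inequalities strict. *)
pose d := Num.min T%:num (e / 2 / (sqn x * C + 1)) / 2.
have m0 : 0 < Num.min T%:num (e / 2 / (sqn x * C + 1)) by rewrite lt_min T0 !divr_gt0.
have d0 : 0 < d by rewrite divr_gt0.
have [dT de] : d < T%:num /\ d < e / 2 / (sqn x * C + 1).
  have : Num.min T%:num (e / 2 / (sqn x * C + 1)) <= T%:num by rewrite ge_min lexx.
  have : Num.min T%:num (e / 2 / (sqn x * C + 1)) <= e / 2 / (sqn x * C + 1).
    by rewrite ge_min lexx orbT.
  by move: m0; rewrite /d; lra.
have [||b [h [hT [m [bE Sm zm]]]]] := Pt (T%:num - d) (e / 2).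
- by apply/andP; split; lra.
- by rewrite divr_gt0.
have hE : h%:num = d by move: (hT); rewrite bE; lra.
have h0 : 0 < h%:num by rewrite hE.
have [p Sp zp] := last_piece h0 Sm.
exists p => //; apply: le_lt_trans zp _.
have := xq h h0; rewrite hE; rewrite ltr_pdivlMr // in de.
by move: zm; lra.
Qed.

End Main.

(** Only the elementary tensors are flipped. The underlying system stays [EF], so the same [S] is a
    subsystem for both orders, and [tens_unit_mem] also treats u (x) F. *)
Program Definition tensor_system_swap (E F : arveson R) (EF : tensor_system E F) :
  tensor_system F E := @TensorSystem R F E EF (fun t y x => tens EF x y) _ _ _.
Next Obligation.
move=> E F EF t; have [[tl tr] ti tT] := tens_tensor EF t; split.
- by split=> [x|y]; [apply: tr|apply: tl].
- by move=> y y' x x'; rewrite ti mulrC.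
rewrite -tT; congr closed_span; apply/seteqP.
by split=> _ [x _ [y _ <-]]; exists y => //; exists x.
Qed.
Next Obligation. by move=> *; rewrite tens_pmul. Qed.
Next Obligation. by move=> E F EF y x My Mx; apply: tens_measurable. Qed.

(** Both sides are intersections, so it suffices that each subsystem [S] containing u' (x) F and E
    (x) v' also contains u (x) F and E (x) v. Each of these follows from [tens_unit_mem], the first
    after the swap. *)
Lemma spatial_product_sub (E F : arveson R) (EF : tensor_system E F)
    (u u' : forall t, E t) (v v' : forall t, F t) :
  normalised_unit u -> normalised_unit u' ->
  normalised_unit v -> normalised_unit v' ->
  forall t, spatial_product EF u v t `<=` spatial_product EF u' v' t.
Proof.
move=> uu uu' uv uv' t z zP S sS Su' Sv'.
have cS r : closed_subspace (S r) by case: sS.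
have Su r : 0 < r%:num -> forall y, S r (tens EF (u' r) y).
  move=> r0 y; apply: Su' => //; apply: mem_tensor_subspace => //.
  by exists 1; rewrite ?scale1r.
have Sv r : 0 < r%:num -> forall x, S r (tens EF x (v' r)).
  move=> r0 x; apply: Sv' => //; apply: mem_tensor_subspace => //.
  by exists 1; rewrite ?scale1r.
apply: zP => // r r0; apply: tensor_subspace_ind => //.
  move=> _ y [a _ <-] _; rewrite (tensZl (tens_tensor EF r)).
  apply: closed_subspaceZ => //.
  exact: (tens_unit_mem (EF := tensor_system_swap EF) uv' uu' uu sS Sv Su y r0).
move=> x _ _ [a _ <-]; rewrite (tensZr (tens_tensor EF r)).
apply: closed_subspaceZ => //.
exact: (tens_unit_mem uu' uv' uv sS Su Sv x r0).
Qed.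

End SpatialProduct.

Theorem theorem6p1 (R : realType) (E F : arveson R) (EF : tensor_system E F)
    (u u' : forall t : {nonneg R}, E t) (v v' : forall t : {nonneg R}, F t) :
  normalised_unit u -> normalised_unit u' ->
  normalised_unit v -> normalised_unit v' ->
  forall t : {nonneg R}, 0 < t%:num ->
    spatial_product EF u v t = spatial_product EF u' v' t.
Proof.
by move=> uu uu' uv uv' t _; apply/seteqP; split; apply: spatial_product_sub.
Qed.
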